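(* Let $G$ be a finite, simple, connected graph with vertex set $V$, maximum degree $m$, and an involution $\sigma$. Let $v\in V$ with $v':=\sigma(v)\ne v$ and $d=d(v,v')$. Let $H=A_G+D_Q$ with potential $Q$ at $v$ and $v'$ and $0$ elsewhere. For every (small) $\epsilon\in(0,1)$, if $$Q\ge \frac{256\,(m+1)}{\epsilon^2},$$ then there exists a time $t$ with $0<t<\frac{\pi}{2}(Q+m)^{d-1}$ such that $p(t)\ge 1-\epsilon$.
   Context: $A_G$ is the adjacency matrix of $G$ and $D_Q$ is the diagonal matrix of the potential. An involution of $G$ is a bijection $\sigma:V\to V$ with $\sigma\circ\sigma=\mathrm{id}$ such that $x\sim y$ implies $\sigma(x)\sim\sigma(y)$. The transfer probability from $v$ to $v'$ at time $t$ is $p(t)=|\langle e_v, e^{itH} e_{v'}\rangle|^2$, where $e_x$ is the standard basis vector of vertex $x$. *)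

(* Defs.v *)
From HB Require Import structures.
From mathcomp Require Import all_boot all_order all_algebra.
From mathcomp Require Import all_classical all_reals all_analysis.
Set Implicit Arguments. Unset Strict Implicit. Unset Printing Implicit Defensive.
Import Order.TTheory GRing.Theory Num.Theory numFieldNormedType.Exports.
Local Open Scope ring_scope.

Definition simple_graph n (e : rel 'I_n) : Prop :=
  symmetric e /\ irreflexive e.

Definition connected_graph n (e : rel 'I_n) : Prop :=
  forall x y : 'I_n, connect e x y.

Definition max_degree n (e : rel 'I_n) : nat :=
  (\max_(x : 'I_n) #|[set y | e x y]|)%N.

Definition graph_involution n (e : rel 'I_n) (s : 'I_n -> 'I_n) : Prop :=
  (forall x, s (s x) = x) /\ (forall x y, e x y -> e (s x) (s y)).

Definition graph_dist n (e : rel 'I_n) (x y : 'I_n) (d : nat) : Prop :=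
  (exists p : seq 'I_n, size p = d /\ path e x p /\ last x p = y) /\
  (forall p : seq 'I_n, path e x p -> last x p = y -> (d <= size p)%N).

Definition adjmx (R : numDomainType) n (e : rel 'I_n) : 'M[R]_n :=
  \matrix_(i, j) (e i j)%:R.

Definition hamiltonian (R : numDomainType) n (e : rel 'I_n) (v v' : 'I_n) (Q : R)
  : 'M[R]_n :=
  adjmx R e + \matrix_(i, j) (if (i == j) && ((i == v) || (i == v')) then Q else 0).

(* matrix powers (valid for every n, including n = 0) *)
Definition mxpow (R : numDomainType) n (M : 'M[R]_n) (k : nat) : 'M[R]_n :=
  iter k (mulmx M) 1%:M.

(* e^{itH} = sum_k (i t)^k / k! H^k ; real and imaginary parts of entry (x,y),
   using Re(i^k) = [k even] (-1)^(k/2), Im(i^k) = [k odd] (-1)^((k-1)/2). *)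
Definition expitH_re (R : realType) n (H : 'M[R]_n) (t : R) (x y : 'I_n) : R :=
  limn (series (fun k : nat =>
     ((if odd k then 0 else (-1) ^+ k./2) * t ^+ k / (k`!)%:R * mxpow H k x y))).

Definition expitH_im (R : realType) n (H : 'M[R]_n) (t : R) (x y : 'I_n) : R :=
  limn (series (fun k : nat =>
     ((if odd k then (-1) ^+ k./2 else 0) * t ^+ k / (k`!)%:R * mxpow H k x y))).

Definition transfer_prob (R : realType) n (H : 'M[R]_n) (x y : 'I_n) (t : R) : R :=
  expitH_re H t x y ^+ 2 + expitH_im H t x y ^+ 2.

(* Main.v *)
Require Import Defs.
From HB Require Import structures.
From mathcomp Require Import all_boot all_order all_algebra.
From mathcomp Require Import all_classical all_reals all_analysis.
From mathcomp Require Import ring lra.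
From mathcomp.real_closed Require Import complex.
Import Order.TTheory GRing.Theory Num.Theory numFieldNormedType.Exports.
Local Open Scope ring_scope.
Set Implicit Arguments. Unset Strict Implicit.

(** Expand [H] in real eigenvectors [u_j] with eigenvalues [l_j].  The amplitude from
    [v] to [w = s v] is half the difference of the Fourier transforms at [t] of the
    spectral measures of [(e_v + e_w) / sqrt 2] and [(e_v - e_w) / sqrt 2].  Both have
    second moment at most [2 m] around [Q], so nearly all their mass lies above [Q / 2];
    and there, by a maximum principle for [l f - A f] off [{v, w}] (valid as [l > m]),
    each charges only one eigenvalue, [l+] and [l-] respectively, up to [8 m / Q^2].

    Let [f+] and [f-] be the eigenfunctions with values [(1, 1)] and [(1, -1)] at
    [(v, w)], [D = l+ - l-] and [b = (f+ + f-) / 2].  Then [D = 2 * sum_(y ~ w) b y],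
    and off [{v, w}] the function [b] solves [A b = l- b + (D / 2) f+], where the last
    term is [O(D m / Q)].  The maximum principle gives [b >= - O(D m / Q^2)], and
    following a shortest path from [v], where [b = 1], to [w] yields
    [(1 + O(m^2 / Q^2)) D >= 2 / (Q + m)^(d - 1)].  At a time slightly before [pi / D]
    the two phases are almost opposite. *)

(** * Spectral expansion of the evolution in a real frame of eigenvectors *)

Lemma mxpow_eigenframe (R : numDomainType) (n : nat) (H : 'M[R]_n) (J : finType)
    (u : J -> 'I_n -> R) (l : J -> R) :
  (forall x y, \sum_j u j x * u j y = (x == y)%:R) ->
  (forall j x, \sum_y H x y * u j y = l j * u j x) ->
  forall k x y, mxpow H k x y = \sum_j l j ^+ k * (u j x * u j y).
Proof.
move=> frame eig; elim=> [|k IH] x y.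
  by rewrite /mxpow /= mxE -frame; apply: eq_bigr => j _; rewrite mul1r.
have -> : mxpow H k.+1 = H *m mxpow H k by [].
rewrite mxE; under eq_bigr => z _ do rewrite IH mulr_sumr.
rewrite exchange_big; apply: eq_bigr => j _ /=.
rewrite exprS -mulrA [_ ^+ _ * _]mulrCA [l j * _]mulrA -eig mulr_suml.
by apply: eq_bigr => z _; ring.
Qed.

Lemma symmetric_eigenframe (R : realType) (n : nat) (H : 'M[R]_n) :
  (forall x y, H x y = H y x) ->
  exists (J : finType) (u : J -> 'I_n -> R) (l : J -> R),
    (forall x y, \sum_j u j x * u j y = (x == y)%:R) /\
    (forall j x, \sum_y H x y * u j y = l j * u j x).
Proof.
(* Diagonalize over R[i]; the real and the imaginary parts of a complex orthonormal
   eigenbasis form a (redundant) real Parseval frame of eigenvectors. *)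
move=> Hsym; pose C : numClosedFieldType := R[i].
pose toC : {rmorphism R -> C} := real_complex R.
pose re : C -> R := @complex.Re R; pose im : C -> R := @complex.Im R.
pose A : 'M[C]_n := map_mx toC H.
have reD : {morph re : a b / a + b} by case=> ? ? [].
have imD : {morph im : a b / a + b} by case=> ? ? [].
have re_sum I (r : seq I) (F : I -> C) : re (\sum_(i <- r) F i) = \sum_(i <- r) re (F i).
  by apply: (big_morph re reD).
have im_sum I (r : seq I) (F : I -> C) : im (\sum_(i <- r) F i) = \sum_(i <- r) im (F i).
  by apply: (big_morph im imD).
have Aherm : A \is hermsymmx.
  apply: realsym_hermsym.
    by apply/is_hermitianmxP/matrixP => i j; rewrite expr0 scale1r !mxE Hsym.
  apply/mxOverP => i j; rewrite mxE; by rewrite complex_real.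
pose P := spectralmx A; pose D := spectral_diag A.
have Pu : P \is unitarymx by apply: spectral_unitarymx.
have PA : P *m A = diag_mx D *m P.
  have /hermitian_normalmx /orthomx_spectralP AE := Aherm.
  by rewrite {1}AE !mulmxA mulmxV ?mul1mx// spectral_unit.
have Dre j : exists d, D 0 j = toC d.
  exists (re (D 0 j)); apply/esym/RRe_real.
  by have /mxOverP := hermitian_spectral_diag_real Aherm.
exists ('I_n + 'I_n)%type,
  (fun j x => match j with inl j => re (P j x) | inr j => im (P j x) end),
  (fun j => match j with inl j => re (D 0 j) | inr j => re (D 0 j) end).
split.
  move=> x y; rewrite big_sumType /= -big_split /=.
  have PP : (P^t* *m P)%sesqui = 1%:M.
    by rewrite -invmx_unitary// mulVmx// spectral_unit.
  (* The real part of [conj a * b] is [re a * re b + im a * im b], so the real part of the unitarity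
     relation is the frame identity. *)
  have := congr1 (fun M : 'M[C]_n => re (M x y)) PP.
  rewrite !mxE re_sum => E.
  have -> : (x == y)%:R = re ((x == y)%:R) by case: (x == y).
  rewrite -E; apply: eq_bigr => j _; rewrite !mxE.
  by case: (P j x) => a b; case: (P j y) => c d; rewrite /re /im /=; ring.
move=> j x; pose i := match j with inl i => i | inr i => i end.
have /(congr1 (fun M : 'M[C]_n => M i x)) := PA.
rewrite mul_diag_mx !mxE; have [d Dd] := Dre i.
have -> : \sum_y P i y * A y x = \sum_y toC (H x y) * P i y.
  by apply: eq_bigr => y _; rewrite mxE mulrC Hsym.
rewrite Dd => E.
(* As [H] and [d] are real, the real and imaginary parts of an eigenvector satisfy the same
   eigenvalue equation. *)
have := congr1 re E; have := congr1 im E; rewrite re_sum im_sum.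
have reM a z : re (toC a * z) = a * re z by case: z => ? ?; rewrite /re /=; ring.
have imM a z : im (toC a * z) = a * im z by case: z => ? ?; rewrite /im /=; ring.
under eq_bigr do rewrite imM; under [in X in _ -> X -> _]eq_bigr do rewrite reM.
rewrite reM imM => ei er.
by case: j @i Dd ei er {E} => i /= ->.
Qed.

Lemma expitH_eigenframe (R : realType) (n : nat) (H : 'M[R]_n) (J : finType)
    (u : J -> 'I_n -> R) (l : J -> R) (t : R) (x y : 'I_n) :
  (forall x y, \sum_j u j x * u j y = (x == y)%:R) ->
  (forall j x, \sum_y H x y * u j y = l j * u j x) ->
  expitH_re H t x y = \sum_j u j x * u j y * cos (t * l j) /\
  expitH_im H t x y = \sum_j u j x * u j y * sin (t * l j).
Proof.
move=> frame eig; split; apply/cvg_lim => //.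
- have -> : series (fun k => (if odd k then 0 else (-1) ^+ k./2) * t ^+ k / k`!%:R
       * mxpow H k x y) =
     fun N => \sum_j u j x * u j y * series (cos_coeff (t * l j)) N.
    apply/funext => N; rewrite /series /=.
    under [RHS]eq_bigr do rewrite mulr_sumr.
    rewrite exchange_big; apply: eq_bigr => k _ /=.
    rewrite (mxpow_eigenframe frame eig) mulr_sumr; apply: eq_bigr => j _.
    rewrite /cos_coeff /= exprMn; case: odd => /=; first by rewrite !mul0r mulr0.
    by rewrite -exprnP; ring.
  apply: cvg_big => [|j _]; [exact: add_continuous | apply: cvgMl_tmp].
  by rewrite unlock; apply: is_cvg_series_cos_coeff.
- have -> : series (fun k => (if odd k then (-1) ^+ k./2 else 0) * t ^+ k / k`!%:R
       * mxpow H k x y) =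
     fun N => \sum_j u j x * u j y * series (sin_coeff (t * l j)) N.
    apply/funext => N; rewrite /series /=.
    under [RHS]eq_bigr do rewrite mulr_sumr.
    rewrite exchange_big; apply: eq_bigr => k _ /=.
    rewrite (mxpow_eigenframe frame eig) mulr_sumr; apply: eq_bigr => j _.
    rewrite /sin_coeff /= exprMn; case ok: (odd k) => /=; last by rewrite !mul0r mulr0.
    have -> : k.-1./2 = k./2.
      by rewrite -[in LHS](odd_double_half k) ok add1n /= doubleK.
    by ring.
  apply: cvg_big => [|j _]; [exact: add_continuous | apply: cvgMl_tmp].
  by rewrite unlock; apply: is_cvg_series_sin_coeff.
Qed.

(** * Eigenfunctions and the maximum principle off [v] and [w] *)

(** This is [H f = l f] in terms of neighbour sums, the form the maximum principle uses. The zero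
    function is allowed, since frame vectors may vanish. *)
Definition eigenfunction (R : realType) (n : nat) (e : rel 'I_n) (v w : 'I_n)
    (Q l : R) (f : 'I_n -> R) : Prop :=
  forall x, \sum_(y | e x y) f y + (if (x == v) || (x == w) then Q else 0) * f x
            = l * f x.

Lemma hamiltonian_act (R : realType) (n : nat) (e : rel 'I_n) (v w : 'I_n) (Q : R)
    (f : 'I_n -> R) (x : 'I_n) :
  \sum_y hamiltonian e v w Q x y * f y =
  \sum_(y | e x y) f y + (if (x == v) || (x == w) then Q else 0) * f x.
Proof.
under eq_bigr do rewrite !mxE mulrDl.
rewrite big_split; congr (_ + _) => /=.
  by rewrite [RHS]big_mkcond; apply: eq_bigr => y _; case: e; rewrite ?mul1r ?mul0r.
rewrite (bigD1 x) //= eqxx big1 ?addr0 // => y /negPf.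
by rewrite eq_sym => ->; rewrite mul0r.
Qed.

Lemma sum_adj_le (R : realType) (n : nat) (e : rel 'I_n) (x : 'I_n)
    (f : 'I_n -> R) (c : R) :
  0 <= c -> (forall y, f y <= c) ->
  \sum_(y | e x y) f y <= (max_degree e)%:R * c.
Proof.
move=> c0 fc; apply: (@le_trans _ _ (\sum_(y | e x y) c)); first by apply: ler_sum.
rewrite sumr_const -[leLHS]mulr_natl ler_wpM2r // ler_nat.
by rewrite -cardsE; apply: (@leq_bigmax _ (fun x => #|[set y | e x y]|)).
Qed.

(** A negative minimum [f x0] lies off [{v, w}], and the neighbour sum there is at least [m * f x0];
    hence [m * f x0 - rho <= l * f x0]. *)
Lemma adj_min_principle (R : realType) (n : nat) (e : rel 'I_n) (v w : 'I_n)
    (l rho : R) (f : 'I_n -> R) :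
  (max_degree e)%:R < l -> 0 <= rho -> 0 <= f v -> 0 <= f w ->
  (forall x, x != v -> x != w -> \sum_(y | e x y) f y - rho <= l * f x) ->
  forall x, - (rho / (l - (max_degree e)%:R)) <= f x.
Proof.
move=> ml rho0 fv fw fint x; set m := (max_degree e)%:R in ml *.
have lm : 0 < l - m by lra.
pose x0 := [arg min_(i < x) f i]%O.
have minf y : f x0 <= f y by rewrite /x0; case: arg_minP => // i _; apply.
apply: le_trans (minf x); have [f0|f0] := leP 0 (f x0).
  by apply: le_trans f0; rewrite oppr_le0 divr_ge0 // ltW.
have x0v : x0 != v by apply: contraTneq f0 => ->; rewrite -leNgt.
have x0w : x0 != w by apply: contraTneq f0 => ->; rewrite -leNgt.
have := fint _ x0v x0w.
have : \sum_(y | e x0 y) - f y <= m * (- f x0).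
  by apply: sum_adj_le => [|y]; [lra | rewrite lerN2].
rewrite sumrN -mulNr ler_pdivrMr // => h1 h2; lra.
Qed.

Lemma adj_max_principle (R : realType) (n : nat) (e : rel 'I_n) (v w : 'I_n)
    (l rho : R) (f : 'I_n -> R) :
  (max_degree e)%:R < l -> 0 <= rho -> f v = 0 -> f w = 0 ->
  (forall x, x != v -> x != w -> `|l * f x - \sum_(y | e x y) f y| <= rho) ->
  forall x, `|f x| <= rho / (l - (max_degree e)%:R).
Proof.
move=> ml rho0 fv fw fint x; rewrite ler_norml; apply/andP; split.
  apply: (@adj_min_principle _ _ _ v w) => //; rewrite ?fv ?fw // => y yv yw.
  by have := fint _ yv yw; rewrite ler_norml => /andP[]; lra.
rewrite -lerN2; apply: (@adj_min_principle _ _ e v w _ _ (fun x => - f x)) => //;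
  rewrite ?fv ?fw ?oppr0 // => y yv yw.
by rewrite sumrN; have := fint _ yv yw; rewrite ler_norml => /andP[]; lra.
Qed.

Lemma eigenfunction_interior (R : realType) (n : nat) (e : rel 'I_n) (v w : 'I_n)
    (Q l : R) (f : 'I_n -> R) :
  eigenfunction e v w Q l f -> forall x, x != v -> x != w ->
  \sum_(y | e x y) f y = l * f x.
Proof. by move=> ef x /negPf xv /negPf xw; rewrite -ef xv xw /= mul0r addr0. Qed.

Lemma eigenfunction_opp (R : realType) (n : nat) (e : rel 'I_n) (v w : 'I_n)
    (Q l : R) (f : 'I_n -> R) :
  eigenfunction e v w Q l f -> eigenfunction e v w Q l (fun x => - f x).
Proof. by move=> ef x; rewrite sumrN !mulrN -ef opprD. Qed.

(** The minimum principle applies to [f + 1] with [rho = 0]: off [{v, w}] its neighbour sum is at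
    most [l * f x + m <= l * (f x + 1)]. *)
Lemma eigenfunction_geN1 (R : realType) (n : nat) (e : rel 'I_n) (v w : 'I_n)
    (Q l : R) (f : 'I_n -> R) :
  eigenfunction e v w Q l f -> (max_degree e)%:R < l ->
  `|f v| <= 1 -> `|f w| <= 1 -> forall x, - 1 <= f x.
Proof.
move=> ef ml; rewrite !ler_norml => /andP[fv _] /andP[fw _] x.
have := @adj_min_principle R n e v w l 0 (fun x => f x + 1) ml (lexx 0).
rewrite mul0r oppr0 => /(_ _ _ _ x) H.
suff : 0 <= f x + 1 by lra.
apply: H; [lra | lra |] => y yv yw.
rewrite big_split /= (eigenfunction_interior ef) //.
have := @sum_adj_le R n e y (fun=> 1) 1 ler01 (fun=> lexx 1).
lra.
Qed.

Lemma eigenfunction_le1 (R : realType) (n : nat) (e : rel 'I_n) (v w : 'I_n)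
    (Q l : R) (f : 'I_n -> R) :
  eigenfunction e v w Q l f -> (max_degree e)%:R < l ->
  `|f v| <= 1 -> `|f w| <= 1 -> forall x, `|f x| <= 1.
Proof.
move=> ef ml fv fw x; rewrite ler_norml (eigenfunction_geN1 ef) //=.
by rewrite -lerN2; apply: (eigenfunction_geN1 (eigenfunction_opp ef));
  rewrite ?normrN.
Qed.

Lemma eigenfunction_small (R : realType) (n : nat) (e : rel 'I_n) (v w : 'I_n)
    (Q l : R) (f : 'I_n -> R) :
  eigenfunction e v w Q l f -> (max_degree e)%:R < l ->
  `|f v| <= 1 -> `|f w| <= 1 -> forall x, x != v -> x != w ->
  `|f x| <= (max_degree e)%:R / l.
Proof.
move=> ef ml fv fw x xv xw.
have l0 : 0 < l by apply: le_lt_trans ml.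
rewrite ler_pdivlMr // mulrC -{1}[l]gtr0_norm // -normrM -(eigenfunction_interior ef) //.
apply: le_trans (ler_norm_sum _ _ _) _; rewrite -[leRHS]mulr1; apply: sum_adj_le => // y.
exact: (eigenfunction_le1 ef).
Qed.

(** The difference [g] vanishes at [v] and [w] and has source [(l1 - l2) * f2] up to sign, so it is
    [O(l1 - l2)] with a small constant. The equations at [v] express [l1 - l2] as a neighbour sum of
    [g], whence [|l1 - l2|] is at most [m^2 / (l2 * (l1 - m)) < 1] times itself. *)
Lemma eigenfunction_unique (R : realType) (n : nat) (e : rel 'I_n) (v w : 'I_n)
    (Q l1 l2 : R) (f1 f2 : 'I_n -> R) :
  eigenfunction e v w Q l1 f1 -> eigenfunction e v w Q l2 f2 ->
  f1 v = 1 -> f2 v = 1 -> f1 w = f2 w -> `|f2 w| <= 1 ->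
  2 * (max_degree e)%:R < l1 -> 2 * (max_degree e)%:R < l2 ->
  l1 = l2.
Proof.
move=> ef1 ef2 f1v f2v f12w f2w; set m := (max_degree e)%:R => ml1 ml2.
have m0 : 0 <= m by rewrite ler0n.
have [//|nl] := eqVneq l1 l2.
have D0 : 0 < `|l1 - l2| by rewrite normr_gt0 subr_eq0.
pose g x := f1 x - f2 x; pose rho := `|l1 - l2| * (m / l2).
have rho0 : 0 <= rho by rewrite mulr_ge0 // divr_ge0 //; lra.
have gb : forall x, `|g x| <= rho / (l1 - m).
  apply: (@adj_max_principle _ _ _ v w); rewrite /g ?f1v ?f2v ?f12w ?subrr -/m //; first by lra.
  move=> x xv xw; rewrite sumrB (eigenfunction_interior ef1) //.
  rewrite (eigenfunction_interior ef2) //.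
  have -> : l1 * (f1 x - f2 x) - (l1 * f1 x - l2 * f2 x) = - ((l1 - l2) * f2 x) by ring.
  rewrite normrN normrM ler_wpM2l //.
  by apply: (eigenfunction_small ef2); rewrite ?f2v ?normr1 -/m //; lra.
have Dv : l1 - l2 = \sum_(y | e v y) g y.
  by rewrite sumrB; have := ef1 v; have := ef2 v; rewrite eqxx /= f1v f2v; lra.
have : `|l1 - l2| <= m * (rho / (l1 - m)).
  by rewrite {1}Dv; apply: le_trans (ler_norm_sum _ _ _) _; apply: sum_adj_le => //;
    rewrite divr_ge0 //; lra.
rewrite mulrA ler_pdivlMr; last by lra.
rewrite /rho mulrCA ler_pM2l //.
have : m * (m / l2) <= m * 1 by rewrite ler_wpM2l // ler_pdivrMr; lra.
lra.
Qed.

(** * Lower bound on the spectral gap along a shortest path *)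

(** On a shortest path, a return to [v] or an early visit to [w] could be cut away to give a shorter
    one. *)
Lemma graph_dist_split (n : nat) (e : rel 'I_n) (v w : 'I_n) (d : nat) :
  w != v -> graph_dist e v w d ->
  exists q, [/\ size q = d.-1, path e v q, e (last v q) w, v \notin q & w \notin q].
Proof.
move=> wv [[p [sp [pp lp]]] short].
case/lastP: p => [|q x] in sp pp lp; first by rewrite -lp eqxx in wv.
rewrite last_rcons in lp; subst x; exists q.
move: pp; rewrite size_rcons in sp; rewrite rcons_path => /andP[pq eqw].
split=> //; first by rewrite -sp.
- apply/negP => vq; case/splitPr: vq sp pq eqw => q1 q2 sp pq eqw.
  have := short (rcons q2 w); rewrite last_rcons rcons_path => /(_ _ erefl).
  move: pq eqw; rewrite cat_path last_cat /= => /and3P[_ _ ->] ->.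
  by move=> /(_ isT); rewrite -sp size_rcons size_cat /= ltnS addnS leqNgt ltnS leq_addl.
- apply/negP => wq; case/splitPr: wq sp pq eqw => q1 q2 sp pq eqw.
  have := short (rcons q1 w); rewrite last_rcons rcons_path => /(_ _ erefl).
  move: pq; rewrite cat_path /= => /and3P[-> -> _] /(_ isT).
  by rewrite -sp size_rcons size_cat /= ltnS addnS leqNgt ltnS leq_addr.
Qed.

(** The shift [f + K] is nonnegative, and the choice of [K] absorbs [rho]: off [{v, w}] its
    neighbour sum is at most [l * (f x + K)]. So each step of the path costs at most a factor
    [l]. *)
Lemma path_decay (R : realType) (n : nat) (e : rel 'I_n) (v w : 'I_n)
    (l rho K : R) (f : 'I_n -> R) (q : seq 'I_n) :
  symmetric e -> 0 < l -> K * (l - (max_degree e)%:R) = rho -> 0 <= K ->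
  1 <= f v -> (forall x, - K <= f x) ->
  (forall x, x != v -> x != w -> \sum_(y | e x y) f y - rho <= l * f x) ->
  path e v q -> v \notin q -> w \notin q ->
  l ^- size q - K <= f (last v q).
Proof.
move=> esym l0 rhoE K0 fv fK fint; elim/last_ind: q => [_ _ _|q x IH] /=.
  by rewrite expr0 invr1; lra.
rewrite rcons_path last_rcons size_rcons !mem_rcons !inE !negb_or.
move=> /andP[pq eqx] /andP[xv vq] /andP[xw wq].
have {IH} := IH pq vq wq; rewrite eq_sym in xv; rewrite eq_sym in xw.
have := fint _ xv xw; set z := last v q in eqx * => H1 H2.
have H3 : \sum_(y | e x y) (f y + K) <= l * f x + rho + (max_degree e)%:R * K.
  rewrite big_split /=; apply: lerD; first by lra.
  exact: (@sum_adj_le _ _ _ _ (fun=> K)).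
have H4 : f z + K <= \sum_(y | e x y) (f y + K).
  rewrite (bigD1 z) /=; last by rewrite esym.
  by rewrite lerDl; apply: sumr_ge0 => y _; have := fK y; lra.
suff : l ^- size q <= l * (f x + K).
  by rewrite exprS invfM lerBlDr ler_pdivrMl.
by rewrite -rhoE in H3; lra.
Qed.

Lemma spectral_gap (R : realType) (n : nat) (e : rel 'I_n) (v w : 'I_n) (d : nat)
    (Q l1 l2 x : R) (f1 f2 : 'I_n -> R) :
  symmetric e -> w != v -> graph_dist e v w d ->
  eigenfunction e v w Q l1 f1 -> eigenfunction e v w Q l2 f2 ->
  f1 v = 1 -> f1 w = 1 -> f2 v = 1 -> f2 w = -1 ->
  2 * (max_degree e)%:R < l1 -> 2 * (max_degree e)%:R < l2 ->
  (max_degree e)%:R ^+ 2 <= x * (l1 * (l2 - (max_degree e)%:R)) -> x < 1 ->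
  0 < l1 - l2 /\ 2 / (Q + (max_degree e)%:R) ^+ d.-1 <= (1 + x) * (l1 - l2).
Proof.
move=> esym wv dist ef1 ef2 f1v f1w f2v f2w; set m := (max_degree e)%:R => ml1 ml2 xm x1.
have m0 : 0 <= m by rewrite ler0n.
have [q [sq pq eqw vq wq]] := graph_dist_split wv dist.
set D := l1 - l2.
pose b z := (f1 z + f2 z) / 2.
(* [rho] bounds the source [D / 2 * f1] off [{v, w}], and [K] is the resulting error in the minimum
   principle. The sign of [D] is still unknown, hence the absolute value. *)
pose rho := `|D| / 2 * (m / l1); pose K := rho / (l2 - m).
have rho0 : 0 <= rho by rewrite mulr_ge0 // divr_ge0 //; lra.
have K0 : 0 <= K by rewrite divr_ge0 //; lra.
have KE : K * (l2 - m) = rho by rewrite divfK // gt_eqF //; lra.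
have bint z : z != v -> z != w -> \sum_(y | e z y) b y - rho <= l2 * b z.
  move=> zv zw; rewrite -mulr_suml big_split /=.
  rewrite (eigenfunction_interior ef1) //.
  rewrite (eigenfunction_interior ef2) //.
  have : `|D / 2 * f1 z| <= rho.
    rewrite normrM normrM [`|2^-1|]ger0_norm ?invr_ge0 //.
    rewrite ler_wpM2l ?divr_ge0 //.
    by apply: (eigenfunction_small ef1); rewrite ?f1v ?f1w ?normr1 -/m //; lra.
  rewrite ler_norml => /andP[_].
  have -> : (l1 * f1 z + l2 * f2 z) / 2 = D / 2 * f1 z + l2 * b z by rewrite /D /b; field.
  by lra.
have bv : b v = 1 by rewrite /b f1v f2v; lra.
have bw : b w = 0 by rewrite /b f1w f2w; lra.
have bK z : - K <= b z.
  apply: (@adj_min_principle _ _ e v w) => //; rewrite ?bv ?bw //; first by rewrite -/m; lra.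
have bq : l2 ^- d.-1 - K <= b (last v q).
  rewrite -sq; apply: (@path_decay _ _ e v w l2 rho) => //; rewrite ?bv //; lra.
(* In the sum of the two equations at [w] the potential cancels, because [f1 w + f2 w = 0]. *)
have DE : D = 2 * \sum_(y | e w y) b y.
  rewrite -mulr_suml big_split /=; have := ef1 w; have := ef2 w.
  by rewrite eqxx orbT f1w f2w /D; lra.
have H3 : \sum_(y | e w y) (b y + K) <= D / 2 + m * K.
  rewrite big_split /=; apply: lerD; first by lra.
  exact: (@sum_adj_le _ _ _ _ (fun=> K)).
have H4 : b (last v q) + K <= \sum_(y | e w y) (b y + K).
  rewrite (bigD1 (last v q)) /=; last by rewrite esym.
  by rewrite lerDl; apply: sumr_ge0 => y _; have := bK y; lra.
have mK : m * K <= x * `|D| / 2.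
  have -> : m * K = `|D| / 2 * (m ^+ 2 / (l1 * (l2 - m))).
    by rewrite /K /rho; field; rewrite !gt_eqF //; lra.
  rewrite [leRHS](_ : _ = `|D| / 2 * x); last by ring.
  by rewrite ler_wpM2l ?divr_ge0 // ler_pdivrMr // mulr_gt0; lra.
have l2Q : l2 <= Q + m.
  have := ef2 v; rewrite eqxx /= f2v => E.
  have : \sum_(y | e v y) f2 y <= m * 1.
    apply: sum_adj_le => // y; apply: le_trans (ler_norm _) _.
    by apply: (eigenfunction_le1 ef2); rewrite ?f2v ?f2w ?normrN ?normr1 -/m //; lra.
  lra.
have l20 : 0 < l2 by lra.
have lX : (Q + m) ^- d.-1 <= l2 ^- d.-1.
  by rewrite lef_pV2 ?posrE ?exprn_gt0 ?lerXn2r ?nnegrE //; lra.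
have T0 : 0 < (Q + m) ^- d.-1 by rewrite invr_gt0 exprn_gt0 //; lra.
have Dge : 2 * (Q + m) ^- d.-1 <= D + x * `|D| by lra.
(* If [D <= 0], then [D + x * |D| = (1 - x) * D <= 0], against the positive lower bound. *)
have D0 : 0 < D.
  rewrite ltNge; apply/negP => Dle; move: Dge; rewrite ler0_norm // => Dge.
  have : D * (1 - x) <= 0 by rewrite mulr_le0_ge0 //; lra.
  lra.
by split=> //; move: Dge; rewrite gtr0_norm //; lra.
Qed.

(** * Concentration of the two spectral measures *)

Lemma frame_parseval (R : realType) (n : nat) (J : finType) (u : J -> 'I_n -> R)
    (a : 'I_n -> R) :
  (forall x y, \sum_j u j x * u j y = (x == y)%:R) ->
  \sum_j (\sum_y a y * u j y) ^+ 2 = \sum_y a y ^+ 2.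
Proof.
move=> frame.
under eq_bigr => j _ do rewrite expr2 mulr_suml.
rewrite exchange_big; apply: eq_bigr => x _ /=.
under eq_bigr => j _ do rewrite mulr_sumr.
rewrite exchange_big /= (bigD1 x) //= [X in _ + X]big1 ?addr0 => [|y yx].
  under eq_bigr => j _ do rewrite mulrACA.
  by rewrite -mulr_sumr frame eqxx mulr1 expr2.
under eq_bigr => j _ do rewrite mulrACA.
by rewrite -mulr_sumr frame eq_sym (negPf yx) mulr0.
Qed.

(** An involution is an automorphism, and [s] swaps [v] and [s v], so composing with [s] preserves
    eigenfunctions. Later [k] is the parity and [c] normalizes the value at [v]. *)
Lemma eigenfunction_sym (R : realType) (n : nat) (e : rel 'I_n) (s : 'I_n -> 'I_n)
    (v : 'I_n) (Q l k c : R) (f : 'I_n -> R) :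
  graph_involution e s -> eigenfunction e v (s v) Q l f ->
  eigenfunction e v (s v) Q l (fun x => (f x + k * f (s x)) / c).
Proof.
move=> [sK es] ef x.
have sI : injective s by apply: can_inj sK.
have esE a b : e (s a) (s b) = e a b.
  by apply/idP/idP => [/es|/es //]; rewrite !sK.
have sv : (s x == v) || (s x == s v) = (x == v) || (x == s v).
  by rewrite (inj_eq sI) orbC -(inj_eq sI x (s v)) sK.
have E : \sum_(y | e x y) f (s y) = \sum_(y | e (s x) y) f y.
  by rewrite [RHS](reindex_inj sI) /=; apply: eq_bigl => y; rewrite esE.
have := ef x; have := ef (s x); rewrite sv -mulr_suml big_split /= -mulr_sumr E => E1 E2.
rewrite !mulrA mulrDr -mulrDl; congr (_ / _).
by rewrite [l * _]mulrDr [l * (k * _)]mulrCA -E1 -E2; ring.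
Qed.

Lemma spectral_concentration (R : realType) (n : nat) (e : rel 'I_n)
    (s : 'I_n -> 'I_n) (v : 'I_n) (Q k : R) (J : finType)
    (u : J -> 'I_n -> R) (l : J -> R) :
  graph_involution e s -> s v != v -> k ^+ 2 = 1 ->
  (forall x y, \sum_j u j x * u j y = (x == y)%:R) ->
  (forall j, eigenfunction e v (s v) Q (l j) (u j)) ->
  4 * (max_degree e)%:R < Q -> 8 * (max_degree e)%:R < Q ^+ 2 ->
  \sum_j (u j v + k * u j (s v)) ^+ 2 / 2 = 1 /\
  exists L f,
    [/\ eigenfunction e v (s v) Q L f, f v = 1, f (s v) = k, Q / 2 < L &
     \sum_(j | l j != L) (u j v + k * u j (s v)) ^+ 2 / 2
       <= 8 * (max_degree e)%:R / Q ^+ 2].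
Proof.
move=> inv svv k2 frame eig; set m := (max_degree e)%:R => mQ mQ2.
have m0 : 0 <= m by rewrite ler0n.
have k1 : `|k| <= 1.
  by move/eqP: k2; rewrite sqrf_eq1 => /orP[] /eqP ->; rewrite ?normrN normr1.
pose U j := u j v + k * u j (s v); pose W j := U j ^+ 2 / 2.
have W0 j : 0 <= W j by rewrite divr_ge0 // sqr_ge0.
have W1 : \sum_j W j = 1.
  rewrite -mulr_suml.
  have -> : \sum_j U j ^+ 2 = \sum_j (u j v * u j v + k ^+ 2 * (u j (s v) * u j (s v))
      + 2 * k * (u j (s v) * u j v)).
    by apply: eq_bigr => j _; rewrite /U; ring.
  by rewrite !big_split /= -!mulr_sumr !frame !eqxx (negPf svv) k2 /= !mulr0n mulr1n mulr0; lra.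
split=> //.
(* [H - Q] maps [e_v + k e_(s v)] to the vector [a] of its neighbour contributions; Parseval turns
   the second moment into half the squared norm of [a]. *)
have W2 : \sum_j (l j - Q) ^+ 2 * W j <= 2 * m.
  pose a y : R := (e v y)%:R + k * (e (s v) y)%:R.
  have aE j : (l j - Q) * U j = \sum_y a y * u j y.
    rewrite /U mulrDr mulrCA !mulrBl -!eig !eqxx orbT /= !addrK.
    rewrite mulr_sumr [in LHS]big_mkcond [X in _ + X]big_mkcond -big_split /=.
    by apply: eq_bigr => y _; rewrite /a; case: (e v y); case: (e (s v) y) => /=; ring.
  have -> : \sum_j (l j - Q) ^+ 2 * W j = (\sum_j (\sum_y a y * u j y) ^+ 2) / 2.
    by rewrite mulr_suml; apply: eq_bigr => j _; rewrite -aE /W; ring.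
  rewrite frame_parseval // ler_pdivrMr //.
  have : \sum_y a y ^+ 2 <= \sum_y (2 * (e v y)%:R + 2 * (e (s v) y)%:R).
    apply: ler_sum => y _; rewrite /a.
    move: k1; rewrite ler_norml => /andP[kN1 k1].
    by case: (e v y); case: (e (s v) y) => /=; nra.
  have deg x : \sum_y (e x y)%:R <= m.
    have := @sum_adj_le R n e x (fun=> 1) 1 ler01 (fun=> lexx 1).
    rewrite mulr1; apply: le_trans; rewrite [leRHS]big_mkcond.
    by apply: ler_sum => y _; case: (e x y).
  rewrite big_split /= -!mulr_sumr; have := deg v; have := deg (s v); lra.
have Q0 : 0 < Q by lra.
(* Chebyshev's inequality: here [(l j - Q)^2 >= Q^2 / 4]. *)
have far j : l j <= Q / 2 -> W j <= 4 / Q ^+ 2 * ((l j - Q) ^+ 2 * W j).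
  move=> lj; rewrite mulrA ler_peMl // mulrAC ler_pdivlMr ?exprn_gt0 // mul1r; nra.
have W2' : 4 / Q ^+ 2 * (\sum_j (l j - Q) ^+ 2 * W j) <= 8 * m / Q ^+ 2.
  rewrite [leRHS](_ : _ = 4 / Q ^+ 2 * (2 * m)); last by ring.
  by rewrite ler_wpM2l // divr_ge0 // sqr_ge0.
have term0 j : 0 <= 4 / Q ^+ 2 * ((l j - Q) ^+ 2 * W j).
  apply: mulr_ge0; first by rewrite divr_ge0 // sqr_ge0.
  by apply: mulr_ge0; rewrite ?sqr_ge0.
(* Otherwise the whole mass 1 would be far from [Q], contradicting [8 m < Q^2]. *)
have [j0 /andP[j0W j0Q]] : exists j, (W j != 0) && (Q / 2 < l j).
  apply/existsP; apply: contraT; rewrite negb_exists => /forallP no.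
  suff : 1 <= 8 * m / Q ^+ 2 by rewrite ler_pdivlMr ?exprn_gt0 //; lra.
  apply: le_trans W2'; rewrite -{1}W1 mulr_sumr; apply: ler_sum => j _.
  have := no j; rewrite negb_and negbK -leNgt => /orP[/eqP E|/far//].
  by rewrite E; have := term0 j; rewrite E.
pose f j x := (u j x + k * u j (s x)) / U j.
have fE j : eigenfunction e v (s v) Q (l j) (f j) by apply: eigenfunction_sym.
have WU j : W j != 0 -> U j != 0.
  by apply: contraNneq => E; rewrite /W E expr0n mul0r.
have fv j : W j != 0 -> f j v = 1 by move=> /WU U0; rewrite /f -/(U j) divff.
have fsv j : W j != 0 -> f j (s v) = k.
  move=> /WU U0; rewrite /f inv.1; apply: (mulIf U0); rewrite divfK // /U.
  by rewrite mulrDr mulrA -expr2 k2; ring.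
exists (l j0), (f j0); split=> //; [exact: fv | exact: fsv |].
apply: le_trans W2'; rewrite mulr_sumr [leRHS](bigID (fun j => l j != l j0)) /=.
apply: ler_wpDr; first by apply: sumr_ge0.
apply: ler_sum => j lj; rewrite -/(U j) -/(W j).
(* A charged eigenvalue above [Q / 2 > 2 m] equals [l j0] by uniqueness, so every other charged one
   is far from [Q]. *)
have [->|Wj] := eqVneq (W j) 0; first by rewrite !mulr0.
apply: far; rewrite leNgt; apply: contraNN lj => ljQ; apply/eqP.
by apply: (eigenfunction_unique (fE j) (fE j0)); rewrite ?fv ?fsv //; rewrite -/m; lra.
Qed.

(** * From concentration to the transfer amplitude *)

(** Only indices off [L] deviate from [c], and there [g j - c >= -2]. *)
Lemma concentrated_sum_ge (R : realType) (J : finType) (l W g : J -> R) (L c h : R) :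
  (forall j, 0 <= W j) -> \sum_j W j = 1 -> \sum_(j | l j != L) W j <= h ->
  (forall j, -1 <= g j) -> c <= 1 -> (forall j, l j = L -> g j = c) ->
  c - 2 * h <= \sum_j W j * g j.
Proof.
move=> W0 W1 Wh gN1 c1 gc.
suff : - (2 * \sum_(j | l j != L) W j) <= \sum_j W j * (g j - c).
  under [X in _ <= X -> _]eq_bigr => j _ do rewrite mulrBr.
  by rewrite sumrB -mulr_suml W1; lra.
rewrite [leRHS](bigID (fun j => l j != L)) /= [X in _ + X]big1 ?addr0.
  rewrite mulr_sumr -sumrN; apply: ler_sum => j _.
  have : 0 <= W j * (g j - c + 2).
    by apply: mulr_ge0 => //; have := gN1 j; lra.
  by lra.
by move=> j; rewrite negbK => /eqP /gc ->; rewrite subrr mulr0.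
Qed.

Lemma sin_le_id (R : realType) (x : R) : 0 <= x -> sin x <= x.
Proof.
move=> x0; have [//|c _] := @MVT_segment R sin cos 0 x x0.
  by apply: continuous_subspaceT => z; apply: continuous_sin.
by rewrite sin0 !subr0 => ->; rewrite ler_piMl // cos_le1.
Qed.

(** Half-angle formula and [sin y <= y] at [y = x / 2]; the bound on [x] keeps this sine
    nonnegative, so squaring is monotone. *)
Lemma cos_ge_quadratic (R : realType) (x : R) : 0 <= x -> x <= 2 -> 1 - x ^+ 2 / 2 <= cos x.
Proof.
move=> x0 x2.
have -> : cos x = 1 - 2 * sin (x / 2) ^+ 2.
  rewrite [in LHS](_ : x = (x / 2) *+ 2); last by rewrite mulr2n; lra.
  by rewrite cos_mulr2n cos2sin2 mulr2n; lra.
have s0 : 0 <= sin (x / 2).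
  by apply: sin_ge0_pi; have := pi_ge2 R; lra.
have : sin (x / 2) ^+ 2 <= (x / 2) ^+ 2.
  by rewrite lerXn2r ?nnegrE ?divr_ge0 //; apply: sin_le_id; lra.
by rewrite exprMn; lra.
Qed.

(* The left-hand side is the square of the component of the amplitude along the unit
   vector i * exp(i t c). *)
Lemma rotated_sum_le_transfer_prob (R : realType) (n : nat) (H : 'M[R]_n) (J : finType)
    (u : J -> 'I_n -> R) (l : J -> R) (t c : R) (x y : 'I_n) :
  (forall x y, \sum_j u j x * u j y = (x == y)%:R) ->
  (forall j x, \sum_y H x y * u j y = l j * u j x) ->
  (\sum_j u j x * u j y * sin (t * (l j - c))) ^+ 2 <= transfer_prob H x y t.
Proof.
move=> frame eig; rewrite /transfer_prob.
have [-> ->] := expitH_eigenframe t x y frame eig.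
set C := \sum_j _ * cos _; set S := \sum_j _ * sin (t * l _).
have -> : \sum_j u j x * u j y * sin (t * (l j - c)) = S * cos (t * c) - C * sin (t * c).
  rewrite !mulr_suml -sumrB; apply: eq_bigr => j _.
  by rewrite mulrBr sinB; ring.
have := cos2Dsin2 (t * c); set a := cos _; set b := sin _ => ab.
rewrite -subr_ge0 [leRHS](_ : _ = (C * a + S * b) ^+ 2) ?sqr_ge0 //.
transitivity ((C ^+ 2 + S ^+ 2) * (a ^+ 2 + b ^+ 2) - (S * a - C * b) ^+ 2).
  by rewrite ab mulr1.
by ring.
Qed.

Unset Implicit Arguments.

Theorem theorem3 (R : realType) (n : nat) (e : rel 'I_n) (s : 'I_n -> 'I_n)
  (v : 'I_n) (d : nat) (Q eps : R) :
  simple_graph e -> connected_graph e -> graph_involution e s ->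
  s v != v -> graph_dist e v (s v) d ->
  0 < eps < 1 ->
  Q >= 256 * ((max_degree e)%:R + 1) / eps ^+ 2 ->
  exists t : R,
    0 < t < pi / 2 * (Q + (max_degree e)%:R) ^+ d.-1 /\
    transfer_prob (hamiltonian e v (s v) Q) v (s v) t >= 1 - eps.
Proof.
move=> [esym _] _ inv svv dist /andP[e0 e1].
have eps2 : 0 < eps ^+ 2 by rewrite exprn_gt0.
rewrite ler_pdivrMr //; set m := (max_degree e)%:R => mQ.
have m0 : 0 <= m by rewrite ler0n.
have Q0 : 0 < Q.
  by have : 0 < Q * eps ^+ 2 by [lra]; rewrite pmulr_lgt0.
have mQ1 : 256 * (m + 1) <= Q * eps.
  by apply: le_trans mQ _; rewrite expr2 mulrA ler_piMr ?mulr_ge0 // ltW.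
have mQ2 : 256 * (m + 1) <= Q.
  by apply: le_trans mQ1 _; rewrite ler_piMr // ltW.
set w := s v in svv dist *; set H := hamiltonian e v w Q.
have Hsym x y : H x y = H y x.
  rewrite !mxE esym [y == x]eq_sym; case: eqVneq => //= ->; congr (_ + _).
have [J [u [l [frame eig]]]] := symmetric_eigenframe Hsym.
have efu j : eigenfunction e v w Q (l j) (u j).
  by move=> x; rewrite -eig -hamiltonian_act.
have m4 : 4 * m < Q by lra.
have m8 : 8 * m < Q ^+ 2 by nra.
have [W1 [lp [fp [efp fpv fpw lpQ Wp]]]] :=
  @spectral_concentration _ _ _ _ _ _ 1 _ _ _ inv svv (expr1n _ _) frame efu m4 m8.
have [W1' [lm [fm [efm fmv fmw lmQ Wm]]]] :=
  @spectral_concentration _ _ _ _ _ _ (-1) _ _ _ inv svv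
    (etrans (sqrrN _) (expr1n _ _)) frame efu m4 m8.
set h := 8 * m / Q ^+ 2 in Wp Wm.
have hle : h <= eps / 1000.
  rewrite ler_pdivrMr ?exprn_gt0 //.
  have : 256 * (256 * m) <= Q * eps * Q by apply: (@le_trans _ _ (256 * (Q * eps))); nra.
  by rewrite expr2; nra.
(* [x] serves twice: as the relative error of the gap bound and as the amount by which [t] falls
   short of [pi / D]. *)
pose x := eps / 100.
have [D0 Dge] : 0 < lp - lm /\ 2 / (Q + m) ^+ d.-1 <= (1 + x) * (lp - lm).
  apply: (@spectral_gap _ _ e v w d Q lp lm x fp fm) => //; rewrite -?/m ?/x; try lra.
  (* [Q^2 / 8] comes from [lp > Q / 2] and [lm - m > Q / 4]. *)
  apply: (@le_trans _ _ (eps / 100 * (Q ^+ 2 / 8))).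
    have : m ^+ 2 <= (Q * eps / 256) ^+ 2 by rewrite lerXn2r ?nnegrE //; nra.
    by rewrite -[eps in leRHS]mulr1; nra.
  rewrite ler_wpM2l ?divr_ge0 //; first by lra.
  by nra.
set D := lp - lm in D0 Dge; set T := (Q + m) ^+ d.-1 in Dge *.
have T0 : 0 < T by rewrite exprn_gt0 //; lra.
have x0 : 0 < x by rewrite /x; lra.
have pi0 := pi_gt0 R; have pi4 : pi < 4 :> R by have := pihalf_lt2 R; lra.
pose t := (1 - 2 * x) * pi / D; exists t.
have tD : t * D = (1 - 2 * x) * pi by rewrite divfK // gt_eqF.
split.
  apply/andP; split; first by rewrite divr_gt0 // mulr_gt0 // /x; lra.
  rewrite ltr_pdivrMr //; move: Dge; rewrite ler_pdivrMr // => Dge.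
  (* Strict because [(1 - 2 x) * (1 + x) < 1]: stopping early pays for the error in the gap. *)
  have H1 : 2 * (1 - 2 * x) < T * D by nra.
  by rewrite mulrC -mulrA -mulrA ltr_pM2l // ; nra.
(* Centring at the midpoint makes the two phases [pi / 2 - a] and its opposite, with sines [cos a]
   and [- cos a]. *)
pose c := (lp + lm) / 2.
apply: le_trans (@rotated_sum_le_transfer_prob _ _ _ _ _ _ t c _ _ frame eig).
pose a := x * pi.
have sinE : sin (t * (lp - c)) = cos a /\ sin (t * (lm - c)) = - cos a.
  have -> : t * (lm - c) = - (t * (lp - c)) by rewrite /c; field.
  have -> : t * (lp - c) = - a + pi / 2.
    have -> : t * (lp - c) = t * D / 2 by rewrite /c /D; field.
    by rewrite tD /a; field.
  by rewrite sinN sinDpihalf cosN.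
have cosa : 1 - eps / 1000 <= cos a.
  have a0 : 0 <= a by rewrite mulr_ge0 // ltW.
  have a4 : a <= 4 * x by rewrite /a mulrC ler_pM2r // ltW.
  apply: le_trans (cos_ge_quadratic a0 _); last by rewrite /x in a4; lra.
  by have : a ^+ 2 <= (4 * x) ^+ 2 by [rewrite lerXn2r ?nnegrE //; lra]; rewrite /x; nra.
have Sp : cos a - 2 * h <= \sum_j (u j v + 1 * u j w) ^+ 2 / 2 * sin (t * (l j - c)).
  apply: (@concentrated_sum_ge _ _ l _ _ lp) => //.
  - by move=> j; rewrite divr_ge0 // sqr_ge0.
  - by move=> j; apply: sin_geN1.
  - by move=> j ->; apply: sinE.1.
have Sm : cos a - 2 * h <= \sum_j (u j v + (-1) * u j w) ^+ 2 / 2 * - sin (t * (l j - c)).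
  apply: (@concentrated_sum_ge _ _ l _ _ lm) => //.
  - by move=> j; rewrite divr_ge0 // sqr_ge0.
  - by move=> j; rewrite lerN2; apply: sin_le1.
  - by move=> j ->; rewrite sinE.2 opprK.
(* Polarization: the product is a quarter of the difference of the squares of sum and difference. *)
have SE : \sum_j u j v * u j w * sin (t * (l j - c)) =
    (\sum_j (u j v + 1 * u j w) ^+ 2 / 2 * sin (t * (l j - c)) +
     \sum_j (u j v + (-1) * u j w) ^+ 2 / 2 * - sin (t * (l j - c))) / 2.
  by rewrite -big_split mulr_suml; apply: eq_bigr => j _ /=; field.
have Lge : 1 - eps / 2 <= \sum_j u j v * u j w * sin (t * (l j - c)) by rewrite SE; lra.
apply: (@le_trans _ _ ((1 - eps / 2) ^+ 2)); first by nra.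
by rewrite lerXn2r ?nnegrE //; lra.
Qed.
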